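(* Let $n_1,n_2,\ldots,n_k\in\mathbb{N}$ with $n_1\geq n_2\geq\cdots\geq n_k\geq 2$. Then $$W(T(2n_1,2n_2,\ldots,2n_k))\leq k+\sum_{i=1}^{k}n_i(2k-i).$$
   Context: All graphs are finite, undirected, without loops or multiple edges. An interval $t$-coloring of a graph $G$ ($t$ a positive integer) is a proper edge-coloring of $G$ with colors $1,\ldots,t$ such that all colors are used and, for each vertex $v$, the set of colors of the edges incident to $v$ is an interval of integers. $G$ is interval colorable if it has an interval $t$-coloring for some positive integer $t$; then $W(G)$ denotes the maximum such $t$. The $k$-dimensional torus $T(m_1,\ldots,m_k)$ ($m_i\ge 3$) is the Cartesian product of cycles $C_{m_1}\square C_{m_2}\square\cdots\square C_{m_k}$, where $C_m$ is the cycle on $m$ vertices. (It is known that $T(m_1,\ldots,m_k)$ is interval colorable whenever $m_1\cdots m_k$ is even.) *)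

(* Defs.v *)
From HB Require Import structures.
From mathcomp Require Import all_boot.

Set Implicit Arguments.
Unset Strict Implicit.
Unset Printing Implicit Defensive.

Record sgraph := SGraph {
  vertex :> finType;
  adj : rel vertex;
  adj_sym : symmetric adj;
  adj_irr : irreflexive adj }.

Section IntervalColoring.
Variable G : sgraph.

Definition edges : {set {set G}} :=
  [set [set p.1; p.2] | p : G * G & adj p.1 p.2].

Section Coloring.
Variable t : nat.

(* A coloring is a function on all sets of vertices, of which only the values
   on edges matter; its values lie in {0, ..., t} and [colors_in_range] excludes
   0 on edges, so that the colors are literally 1, ..., t. *)
Variable c : {ffun {set G} -> 'I_t.+1}.

Definition colors_in_range : bool := [forall e in edges, 0 < c e].

Definition proper_coloring : bool :=
  [forall e in edges, forall f in edges,
     (e != f) && (e :&: f != set0) ==> (c e != c f)].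

Definition all_colors_used : bool :=
  [forall a : 'I_t.+1, (0 < a) ==> [exists e in edges, c e == a]].

Definition spectrum (v : G) : {set 'I_t.+1} :=
  [set c e | e : {set G} in edges & v \in e].

Definition is_interval (S : {set 'I_t.+1}) : bool :=
  [forall a in S, forall b in S, forall d : 'I_t.+1,
     (a <= d <= b) ==> (d \in S)].

Definition interval_coloring : bool :=
  [&& colors_in_range, proper_coloring, all_colors_used
    & [forall v, is_interval (spectrum v)]].

End Coloring.

Definition has_interval_coloring (t : nat) : bool :=
  (0 < t) && [exists c : {ffun {set G} -> 'I_t.+1}, interval_coloring c].

Definition interval_colorable : Prop := exists t, has_interval_coloring t.

(* An interval t-coloring uses all t colors, so t is at most the number of
   edges: the bound on t below is harmless, see [W_greatest]. The value is 0
   when G is not interval colorable. *)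
Definition W : nat := \max_(t < #|edges|.+1 | has_interval_coloring t) t.

Lemma has_interval_coloring_bound t : has_interval_coloring t -> t <= #|edges|.
Proof.
case/andP=> _ /existsP[c /and4P[_ _ /forallP used _]].
have sub : [set lift ord0 a | a : 'I_t] \subset [set c e | e in edges].
  apply/subsetP=> _ /imsetP[a _ ->].
  have /existsP[e /andP[eE /eqP <-]] := implyP (used (lift ord0 a)) isT.
  exact: imset_f.
apply: leq_trans (leq_imset_card c _); apply: leq_trans (subset_leq_card sub).
by rewrite card_imset ?card_ord //; apply: lift_inj.
Qed.

Lemma W_greatest :
  interval_colorable ->
  has_interval_coloring W /\ forall t, has_interval_coloring t -> t <= W.
Proof.
case=> t0 ht0; have lt0 : t0 < #|edges|.+1.
  by rewrite ltnS has_interval_coloring_bound.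
split=> [|t ht].
  pose P := [pred t : 'I_#|edges|.+1 | has_interval_coloring t].
  have P_gt0 : 0 < #|P| by apply/card_gt0P; exists (Ordinal lt0).
  have [t ht eqW] := eq_bigmax_cond (@nat_of_ord _) P_gt0.
  have -> : W = t by rewrite -eqW; apply: eq_bigl.
  exact: ht.
have lt : t < #|edges|.+1 by rewrite ltnS has_interval_coloring_bound.
by rewrite /W (leq_bigmax_cond (Ordinal lt)).
Qed.

End IntervalColoring.

(* For m >= 3 this is C_m; the condition i != j only matters for m = 1. *)
Definition cycle_adj (m : nat) : rel 'I_m :=
  [rel i j : 'I_m | (i != j) && ((i.+1 %% m == j) || (j.+1 %% m == i))].

Lemma cycle_adj_sym m : symmetric (@cycle_adj m).
Proof. by move=> i j; rewrite /cycle_adj /= eq_sym orbC. Qed.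

Lemma cycle_adj_irr m : irreflexive (@cycle_adj m).
Proof. by move=> i; rewrite /cycle_adj /= eqxx. Qed.

Definition cycle_graph (m : nat) : sgraph :=
  SGraph (@cycle_adj_sym m) (@cycle_adj_irr m).

Section CartesianProduct.
Variables (k : nat) (G : 'I_k -> sgraph).

Definition cartesian_vertex : finType := {dffun forall i : 'I_k, G i}.

Definition cartesian_adj : rel cartesian_vertex :=
  [rel x y : cartesian_vertex | [exists i : 'I_k,
     adj (x i) (y i) && [forall j : 'I_k, (j != i) ==> (x j == y j)]]].

Lemma cartesian_adj_sym : symmetric cartesian_adj.
Proof.
move=> x y; apply: eq_existsb => i; rewrite adj_sym; congr (_ && _).
by apply: eq_forallb => j; rewrite [y j == _]eq_sym.
Qed.

Lemma cartesian_adj_irr : irreflexive cartesian_adj.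
Proof. by move=> x; apply/existsP=> -[i]; rewrite adj_irr. Qed.

Definition cartesian_product : sgraph :=
  SGraph cartesian_adj_sym cartesian_adj_irr.

End CartesianProduct.

Definition torus (k : nat) (m : 'I_k -> nat) : sgraph :=
  cartesian_product (fun i => cycle_graph (m i)).

(* Main.v *)
Require Import Defs.
From mathcomp Require Import all_boot.
From mathcomp Require Import zify.

(** Let c be an interval t-coloring of the torus, {v, u} an edge of color 1 and
    {w, z} an edge of color t. The proof walks greedily along a geodesic from v
    to w and bounds how fast colors can grow.

    At a vertex of degree 2k the colors form an interval of 2k integers; so
    among any r edges at that vertex, one has a color exceeding the color of a
    given edge there by at most 2k - r ([interval_coloring_exchange]). Let d_i
    be the distance to w in the i-th coordinate. The number of edges leading
    closer to w is at least the number of active coordinates, those with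
    d_i > 0, plus the number of antipodal ones, those with d_i = n_i
    ([torus_exchange]). Walking each time along the lightest such edge costs at
    most 2k - #{active coordinates} per step.

    The total is controlled by the potential
      Phi(d) = sum_i d_(i) (2k - i),   d_(1) >= ... >= d_(k) the sorted d,
    which is handled without sorting through
      2 Phi(d) = (4k - 1) sum_i d_i - sum_(i, j) min(d_i, d_j).
    Lowering an active d_l by 1 lowers Phi by 2k - #{i | d_i >= d_l}, which is
    at least 2k - #{active coordinates} ([min_sum_step]). The edge {w, z} costs
    at most 2k - 1 more than the last edge of the walk, so t <= 2k + Phi(d)
    ([torus_color_gap]).

    The claimed bound is k + Phi(n) ([min_sum_noninc]), so k is still to be
    saved. If some d_i < n_i, then Phi(d) <= Phi(n) - k because every unit of
    distance contributes at least k to Phi ([min_sum_mono]). If d = n, then all 2k edges at v lead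
    closer to w: the first step costs nothing, while Phi drops by at least k. *)

(** * Interval colorings and the exchange step *)

Lemma edgeP (G : sgraph) (e : {set G}) :
  reflect (exists u v : G, adj u v /\ e = [set u; v]) (e \in edges G).
Proof.
apply: (iffP imsetP) => [[[u v] /= uv ->]|[u [v [uv ->]]]].
  by exists u, v; rewrite inE in uv.
by exists (u, v); rewrite ?inE.
Qed.

Lemma edge_at (G : sgraph) (e : {set G}) (v : G) :
  e \in edges G -> v \in e -> exists2 u, adj v u & e = [set v; u].
Proof.
case/edgeP=> [a [b [ab ->]]]; rewrite !inE => /orP[]/eqP->; first by exists b.
by exists a; rewrite 1?adj_sym 1?setUC.
Qed.

Lemma edge_inj (G : sgraph) (v u1 u2 : G) :
  adj v u1 -> [set v; u1] = [set v; u2] -> u1 = u2.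
Proof.
move=> vu1 E; have : u1 \in [set v; u2] by rewrite -E set22.
rewrite !inE => /orP[]/eqP // u1v.
by rewrite u1v adj_irr in vu1.
Qed.

(** Let m be the least color on F and x that of {v, u0}. The colors x, ..., m - 1
    belong to the spectrum by convexity and are not used on F, so together with
    the #|F| colors of F they give m - x + #|F| elements of the spectrum. *)
Lemma interval_coloring_exchange (G : sgraph) (t : nat)
    (c : {ffun {set G} -> 'I_t.+1}) (v u0 : G) (F : {set G}) :
  interval_coloring c -> adj v u0 -> F != set0 ->
  {in F, forall u, adj v u} ->
  exists2 u, u \in F & c [set v; u] + #|F| <= c [set v; u0] + #|spectrum c v|.
Proof.
move=> /and4P[_ prop _ /forallP/(_ v) intv] vu0 /set0Pn[u1 u1F] Fadj.
case: (arg_minnP (fun u => nat_of_ord (c [set v; u])) u1F) => u uF umin.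
exists u => //.
have vE w : adj v w -> [set v; w] \in edges G.
  by move=> vw; apply/edgeP; exists v, w.
have specE w : adj v w -> c [set v; w] \in spectrum c v.
  by move=> vw; apply/imsetP; exists [set v; w]; rewrite // inE vE ?set21.
have cinj : {in F &, injective (fun w => c [set v; w])}.
  move=> w1 w2 w1F w2F /eqP cE; apply: (@edge_inj _ v); first exact: Fadj.
  apply/eqP; apply/contraT => ne; move: prop.
  move/forall_inP/(_ _ (vE _ (Fadj _ w1F))).
  move/forall_inP/(_ _ (vE _ (Fadj _ w2F)))/implyP; rewrite ne cE /=; apply.
  by apply/set0Pn; exists v; rewrite !inE eqxx.
pose A := [set c [set v; w] | w in F].
pose B := [set d : 'I_t.+1 | c [set v; u0] <= d < c [set v; u]].
have cardA : #|A| = #|F| by rewrite card_in_imset.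
have cardB : c [set v; u] - c [set v; u0] <= #|B|.
  have lt (i : 'I_(c [set v; u] - c [set v; u0])) :
    c [set v; u0] + i < t.+1.
    apply: leq_trans (ltn_ord (c [set v; u])).
    by rewrite ltnS ltnW // -ltn_subRL.
  have inj : injective (fun i => Ordinal (lt i)).
    by move=> i j [] /addnI /val_inj.
  rewrite -[X in X <= _]card_ord -(card_imset _ inj) subset_leq_card //.
  apply/subsetP=> _ /imsetP[i _ ->].
  by rewrite inE /= leq_addr -ltn_subRL ltn_ord.
have AB0 : A :&: B = set0.
  apply/setP=> d; rewrite !inE; apply/negP=> /andP[/imsetP[w wF ->]].
  by have := umin w wF; lia.
have : A :|: B \subset spectrum c v.
  apply/subsetP=> d; rewrite inE => /orP[/imsetP[w wF ->]|].
    by rewrite specE // Fadj.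
  rewrite inE => /andP[dge dlt]; move/forall_inP/(_ _ (specE _ vu0)): intv.
  move/forall_inP/(_ _ (specE _ (Fadj _ uF)))/forallP/(_ d)/implyP; apply.
  by rewrite dge ltnW.
move/subset_leq_card; rewrite cardsU AB0 cards0 cardA subn0 => AB.
apply: leq_trans (leq_add (leqnn _) AB).
by rewrite [#|F| + _]addnC addnA leq_add2r -leq_subLR.
Qed.

(** * The potential *)

(** The sum of minima replaces the sorted rearrangement of d: when d is
    nonincreasing and i counts from 1, the sum of the i * d_i is the sum of
    min(d_i, d_j) over the pairs with i <= j. *)
Definition min_sum {k : nat} (d : 'I_k -> nat) : nat :=
  \sum_(i < k) \sum_(j < k) minn (d i) (d j).

(** Only pairs that involve l change, by at most 1, and only if their other
    member is nonzero; the pair (l, l) would be counted twice. *)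
Lemma min_sum_step (k : nat) (d d' : 'I_k -> nat) (l : 'I_k) :
  d l = (d' l).+1 -> (forall i, i != l -> d i = d' i) ->
  min_sum d + 1 <= min_sum d' + 2 * \sum_(i < k) (0 < d i).
Proof.
move=> dl dE.
have one : \sum_(i < k) \sum_(j < k) (i == l) * (j == l) = 1.
  rewrite (bigD1 l) //= (bigD1 l) //= eqxx big1 => [|j /negPf->]; last by lia.
  by rewrite big1 // => i /negPf->; rewrite big1.
have act : \sum_(i < k) \sum_(j < k) (i == l) * (0 < d j) = \sum_(i < k) (0 < d i).
  rewrite (bigD1 l) //= [X in _ + X]big1 => [|i /negPf->]; last by rewrite big1.
  by rewrite addn0 eqxx; apply: eq_bigr => j _; rewrite mul1n.
rewrite -{}[X in _ + X <= _]one mul2n -addnn -{1}act -{}act.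
rewrite [X in _ + (_ + X)]exchange_big -!big_split; apply: leq_sum => i _.
rewrite -!big_split; apply: leq_sum => j _ /=.
case: (eqVneq i l) => [->|/dE ->]; case: (eqVneq j l) => [->|/dE ->]; lia.
Qed.

(** In terms of the potential: with s the sum of the n i - d i, the inequality
    says that Phi(d) + k s <= Phi(n). Each off-diagonal minimum grows by at most
    the sum of the growths of its two members. *)
Lemma min_sum_mono (k : nat) (d n : 'I_k -> nat) :
  (forall i, d i <= n i) ->
  min_sum n + \sum_(i < k) (n i - d i) <=
  min_sum d + 2 * (k * \sum_(i < k) (n i - d i)).
Proof.
move=> dn; set s := fun i => n i - d i.
have diag : \sum_(i < k) \sum_(j < k) (i == j) * s i = \sum_(i < k) s i.
  apply: eq_bigr => i _; rewrite (bigD1 i) //= eqxx mul1n big1 ?addn0 // => j.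
  by rewrite eq_sym => /negPf->.
have row : \sum_(i < k) \sum_(j < k) s j = k * \sum_(i < k) s i.
  by rewrite sum_nat_const card_ord.
rewrite mul2n -addnn -row {2}exchange_big -[X in _ + X <= _]diag -!big_split.
apply: leq_sum => i _; rewrite -!big_split; apply: leq_sum => j _ /=.
rewrite /s; have := dn i; have := dn j.
by case: (eqVneq i j) => [->|_]; lia.
Qed.

(** The pairs with j <= i and those with i <= j contribute equally, and the two
    families share the diagonal. *)
Lemma min_sum_noninc (k : nat) (n : 'I_k -> nat) :
  (forall i j : 'I_k, i <= j -> n j <= n i) ->
  min_sum n + \sum_(i < k) n i = 2 * \sum_(i < k) n i * i.+1.
Proof.
move=> n_noninc.
have low : \sum_(i < k) \sum_(j < k) (j <= i) * minn (n i) (n j) =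
           \sum_(i < k) n i * i.+1.
  apply: eq_bigr => i _; rewrite -[i.+1]card_ord -sum1_card big_distrr /=.
  under [RHS]eq_bigr do rewrite muln1.
  rewrite (big_ord_widen k (fun=> n i)) ?ltn_ord // [RHS]big_mkcond /=.
  apply: eq_bigr => j _; rewrite ltnS; case: leqP => [ji|]; last by [].
  by rewrite mul1n; apply/minn_idPl; apply: n_noninc.
have diag : \sum_(i < k) \sum_(j < k) (i == j) * n i = \sum_(i < k) n i.
  apply: eq_bigr => i _; rewrite (bigD1 i) //= eqxx mul1n big1 ?addn0 // => j.
  by rewrite eq_sym => /negPf->.
rewrite mul2n -addnn -low {2}exchange_big -[X in _ + X = _]diag -!big_split.
apply: eq_bigr => i _; rewrite -!big_split; apply: eq_bigr => j _ /=.
rewrite -val_eqE /=; case: ltngtP => [||/val_inj ->]; lia.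
Qed.

(** * Distances in an even cycle *)

(** The graph distance in the cycle: of the two arcs between a and b, one has
    length |a - b|, written here with truncated subtractions. *)
Definition cycle_dist {m : nat} (a b : 'I_m) : nat :=
  minn ((a - b) + (b - a)) (m - ((a - b) + (b - a))).

Definition cycle_step_val (m : nat) (s : bool) (a : nat) : nat :=
  if s then if a.+1 == m then 0 else a.+1 else if a == 0 then m.-1 else a.-1.

Lemma cycle_step_subproof (m : nat) (s : bool) (a : 'I_m) :
  cycle_step_val m s a < m.
Proof. by have := ltn_ord a; rewrite /cycle_step_val; case: s; case: eqP; lia. Qed.

Definition cycle_step {m : nat} (s : bool) (a : 'I_m) : 'I_m :=
  Ordinal (cycle_step_subproof m s a).

Lemma cycle_adjE (m : nat) (a b : cycle_graph m) :
  1 < m -> adj a b = [exists s, b == cycle_step s a].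
Proof.
move: a b => /= a b m1; rewrite /cycle_adj /=.
have modS (i : 'I_m) : i.+1 %% m = if i.+1 == m then 0 else i.+1.
  case: eqP => [->|]; first by rewrite modnn.
  by have := ltn_ord i; move=> *; rewrite modn_small //; lia.
have am := ltn_ord a; have bm := ltn_ord b.
rewrite !modS -val_eqE /=; apply/idP/existsP.
  case/andP=> ab /orP[] h; [exists true|exists false];
    rewrite -val_eqE /= /cycle_step_val; move: h; do ?case: eqP; lia.
by case=> -[]; rewrite -val_eqE /= /cycle_step_val; do ?case: eqP; lia.
Qed.

Lemma cycle_step_inj (m : nat) (a : 'I_m) :
  2 < m -> injective (fun s => cycle_step s a).
Proof.
move=> m2 s1 s2 [] /eqP; have := ltn_ord a.
by case: s1; case: s2 => //; rewrite /cycle_step_val; do ?case: eqP; lia.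
Qed.

Lemma cycle_dist_le (n : nat) (a b : 'I_(2 * n)) : cycle_dist a b <= n.
Proof. by rewrite /cycle_dist; lia. Qed.

Lemma cycle_dist_eq0 (m : nat) (a b : 'I_m) : cycle_dist a b = 0 -> a = b.
Proof.
have := ltn_ord a; have := ltn_ord b; rewrite /cycle_dist => *.
by apply: val_inj => /=; lia.
Qed.

(** At least one of the two neighbors of a is closer to b when a differs from b,
    and both are when a and b are antipodal. *)
Lemma cycle_closer_steps (n : nat) (a b : 'I_(2 * n)) :
  (0 < cycle_dist a b) + (cycle_dist a b == n) <=
  \sum_(s : bool)
     (cycle_dist a b == (cycle_dist (cycle_step s a) b).+1).
Proof.
have am := ltn_ord a; have bm := ltn_ord b; rewrite big_bool.
have [Dn|Dn] := eqVneq (cycle_dist a b) n.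
  suff E s : cycle_dist a b = (cycle_dist (cycle_step s a) b).+1.
    by rewrite -!E !eqxx; case: (0 < _).
  rewrite Dn; move: Dn; rewrite /cycle_dist /= /cycle_step_val.
  by case: s; case: eqP; lia.
have [//|D0] := posnP (cycle_dist a b).
suff [s E] : exists s, cycle_dist a b =
                       (cycle_dist (cycle_step s a) b).+1.
  by case: s E => <-; rewrite eqxx //= addn1.
(* Going up is right exactly when b lies at most n - 1 steps above a. *)
exists (if a < b then b - a < n else n < a - b).
rewrite /cycle_dist /= /cycle_step_val in Dn D0 *.
case: (ltnP a b) => ab; [case: (ltnP (b - a) n) => h|case: (ltnP n (a - b)) => h];
  by case: eqP => e; lia.
Qed.

(** * Geodesic steps in the torus *)

Definition torus_step {k : nat} {m : 'I_k -> nat} (v : torus m)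
    (p : 'I_k * bool) : torus m :=
  [ffun j => if j == p.1 then cycle_step p.2 (v j) else v j].

Lemma torus_adjE (k : nat) (m : 'I_k -> nat) (v u : torus m) :
  (forall i, 1 < m i) -> adj v u = [exists p, u == torus_step v p].
Proof.
move=> m_gt1; apply/existsP/existsP => [[i /andP[]]|[[i s] /eqP->]].
  rewrite cycle_adjE // => /existsP[s /eqP us] /forallP eqv; exists (i, s).
  apply/eqP/ffunP=> j; rewrite ffunE /=; case: eqVneq => [->|ji] //.
  by move: (implyP (eqv j) ji) => /eqP->.
exists i; rewrite cycle_adjE // ffunE eqxx /=; apply/andP; split.
  by apply/existsP; exists s.
by apply/forallP=> j; apply/implyP=> /negPf ji; rewrite ffunE /= ji.
Qed.

Lemma torus_step_inj (k : nat) (m : 'I_k -> nat) (v : torus m) :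
  (forall i, 2 < m i) -> injective (torus_step v).
Proof.
move=> m_gt2 [i s] [j r] /ffunP E; have := E i; rewrite !ffunE /= eqxx.
case: eqVneq => [->|_ sv]; first by move/cycle_step_inj->.
have : adj (v i : cycle_graph (m i)) (v i).
  rewrite cycle_adjE 1?ltnW //; apply/existsP; exists s.
  by rewrite sv.
by rewrite adj_irr.
Qed.

Lemma card_torus_spectrum (k : nat) (m : 'I_k -> nat) (t : nat)
    (c : {ffun {set torus m} -> 'I_t.+1}) (v : torus m) :
  (forall i, 1 < m i) -> #|spectrum c v| <= 2 * k.
Proof.
move=> m_gt1; have sub : spectrum c v \subset
    [set c [set v; torus_step v p] | p in [set: 'I_k * bool]].
  apply/subsetP=> _ /imsetP[e + ->]; rewrite inE => /andP[eE ve].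
  have [u] := edge_at _ _ _ eE ve.
  by rewrite torus_adjE // => /existsP[p /eqP->] ->; apply: imset_f.
apply: leq_trans (subset_leq_card sub) _.
apply: leq_trans (leq_imset_card _ _) _.
by rewrite cardsT card_prod card_ord card_bool mulnC.
Qed.

Definition torus_dist {k : nat} (n : 'I_k -> nat)
    (v w : torus (fun i => 2 * n i)) (i : 'I_k) : nat :=
  cycle_dist (v i) (w i).

(** The exchange step applied to the set of all neighbors of v that are closer
    to w. *)
Lemma torus_exchange (k : nat) (n : 'I_k -> nat) (t : nat)
    (c : {ffun {set torus (fun i => 2 * n i)} -> 'I_t.+1})
    (v u w : torus (fun i => 2 * n i)) (i : 'I_k) :
  (forall i, 2 <= n i) -> interval_coloring c -> adj v u ->
  0 < torus_dist n v w i ->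
  exists u' : torus (fun i => 2 * n i), exists l : 'I_k,
  [/\ adj v u',
      torus_dist n v w l = (torus_dist n u' w l).+1,
      forall j, j != l -> torus_dist n v w j = torus_dist n u' w j
    & c [set v; u'] + (\sum_(j < k) (0 < torus_dist n v w j) +
                        \sum_(j < k) (torus_dist n v w j == n j)) <=
         c [set v; u] + 2 * k].
Proof.
move=> n_ge2 cint vu di.
have m_gt1 j : 1 < 2 * n j by have := n_ge2 j; lia.
have m_gt2 j : 2 < 2 * n j by have := n_ge2 j; lia.
pose closer (p : 'I_k * bool) := torus_dist n v w p.1
  == (cycle_dist (cycle_step p.2 (v p.1)) (w p.1)).+1.
pose F := [set torus_step v p | p in [set p | closer p]].
have cardF : \sum_(j < k) ((0 < torus_dist n v w j)
                         + (torus_dist n v w j == n j)) <= #|F|.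
  rewrite card_imset; last exact: torus_step_inj.
  rewrite -sum1dep_card [leqRHS]big_mkcond.
  rewrite [leqRHS](eq_bigr (fun p => nat_of_bool (closer (p.1, p.2)))); last first.
    by move=> [j s] _ /=; case: (closer _).
  rewrite -(pair_bigA _ (fun j s => nat_of_bool (closer (j, s)))) /=.
  by apply: leq_sum => j _; apply: cycle_closer_steps.
have F0 : F != set0.
  rewrite -card_gt0; apply: leq_trans cardF; rewrite (bigD1 i) //= di.
  by rewrite -addnA.
have Fadj : {in F, forall u', adj v u'}.
  by move=> _ /imsetP[p _ ->]; rewrite torus_adjE //; apply/existsP; exists p.
have [u' u'F cu'] := interval_coloring_exchange _ _ _ _ _ _ cint vu F0 Fadj.
have vu' := Fadj _ u'F.
case/imsetP: u'F cu' vu' => -[l s]; rewrite inE /closer /= => /eqP dl ->.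
move=> cu' vu'; exists (torus_step v (l, s)), l; split=> //.
- by rewrite dl /torus_dist ffunE eqxx.
- by move=> j /negPf jl; rewrite /torus_dist ffunE /= jl.
rewrite -big_split; apply: leq_trans (leq_trans (leq_add (leqnn _) cardF) cu') _.
by rewrite leq_add2l card_torus_spectrum.
Qed.

Lemma sum_decrement (k : nat) (d d' : 'I_k -> nat) (l : 'I_k) :
  d l = (d' l).+1 -> (forall i, i != l -> d i = d' i) ->
  \sum_(i < k) d i = (\sum_(i < k) d' i).+1.
Proof.
move=> dl dE; rewrite (bigD1 l) //= [in RHS](bigD1 l) //= dl addSn.
by congr (_ + _).+1; apply: eq_bigr => i /dE.
Qed.

(** This is twice the inequality c {w, z} + 1 <= c {v, u} + 2k + Phi(d), with all
    negative terms moved across to avoid truncated subtraction. At distance 0 it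
    is the exchange step for the single edge {w, z}. *)
Lemma torus_color_gap (k : nat) (n : 'I_k -> nat) (t : nat)
    (c : {ffun {set torus (fun i => 2 * n i)} -> 'I_t.+1})
    (v u w z : torus (fun i => 2 * n i)) :
  (forall i, 2 <= n i) -> interval_coloring c -> adj v u -> adj w z ->
  2 * c [set w; z] + 2 + min_sum (torus_dist n v w)
    + \sum_(i < k) torus_dist n v w i <=
  2 * c [set v; u] + 4 * k + 4 * (k * \sum_(i < k) torus_dist n v w i).
Proof.
move=> n_ge2 cint vu wz; set D := \sum_(i < k) _.
have [N] := ubnP D; rewrite {}/D; elim: N v u vu => // N IH v u vu.
set d := torus_dist n v w; set D := \sum_(i < k) _ => DN.
have [i di|d0] := pickP (fun i => 0 < d i).
  have [u' [l [vu' dl dE cu']]] :=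
    torus_exchange _ _ _ _ _ _ _ _ n_ge2 cint vu di.
  have DE := sum_decrement _ _ _ _ dl dE; have u'v : adj u' v by rewrite adj_sym.
  have M := min_sum_step _ _ _ _ dl dE.
  have := IH u' v u'v; rewrite [[set u'] :|: _]setUC; rewrite -/d -/D in DE M cu' *.
  rewrite -ltnS -DE => /(_ DN); rewrite DE mulnS; lia.
have vw : v = w.
  by apply/ffunP=> i; apply: cycle_dist_eq0; apply/eqP; rewrite -leqn0 leqNgt d0.
have [d0E m0] : D = 0 /\ min_sum d = 0.
  have d0' i : d i = 0 by apply/eqP; rewrite -leqn0 leqNgt d0.
  split; first by rewrite /D big1.
  by rewrite /min_sum big1 // => i _; rewrite big1 // => j _; rewrite !d0'.
rewrite {DN}d0E m0; subst w.
have z0 : [set z] != set0 by apply/set0Pn; exists z; rewrite inE.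
have zadj : {in [set z], forall y, adj v y} by move=> y; rewrite inE => /eqP->.
have [y] := interval_coloring_exchange _ _ _ _ _ _ cint vu z0 zadj.
rewrite cards1 inE => /eqP-> le.
have m_gt1 i : 1 < 2 * n i by have := n_ge2 i; lia.
have := leq_trans le (leq_add (leqnn _) (card_torus_spectrum _ _ _ c v m_gt1)).
lia.
Qed.

(** * The bound *)

Lemma colors_used (G : sgraph) (t a : nat) (c : {ffun {set G} -> 'I_t.+1}) :
  interval_coloring c -> 0 < a <= t ->
  exists u v : G, adj u v /\ c [set u; v] = a :> nat.
Proof.
case/and4P=> _ _ /forallP used _ /andP[a0 at_].
have /implyP := used (inord a); rewrite inordK // => /(_ a0).
case/existsP=> e /andP[/edgeP[u [v [uv ->]]] /eqP cE].
by exists u, v; rewrite cE inordK.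
Qed.

Theorem corollary5p3 (k : nat) (n : 'I_k -> nat)
    (k_gt0 : 0 < k)
    (n_noninc : forall i j : 'I_k, i <= j -> n j <= n i)
    (n_ge2 : forall i : 'I_k, 2 <= n i) :
  W (torus (fun i : 'I_k => 2 * n i)) <=
    k + \sum_(i < k) n i * (2 * k - i.+1).
Proof.
apply/bigmax_leqP=> t' /andP[]; move: (nat_of_ord t') => t {t'} t0 ex_c.
have {ex_c} [c cint] : exists c : {ffun {set torus (fun i => 2 * n i)} -> 'I_t.+1},
  interval_coloring c by apply/existsP.
have [v [u [vu c1]]] := colors_used _ _ 1 _ cint t0.
have t_range : 0 < t <= t by rewrite t0 /=.
have [w [z [wz ct]]] := colors_used _ _ t _ cint t_range.
set d := torus_dist n v w.
have dn i : d i <= n i by apply: cycle_dist_le.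
set N := \sum_(i < k) n i; set D := \sum_(i < k) d i.
have NE : \sum_(i < k) n i * (2 * k - i.+1) + \sum_(i < k) n i * i.+1 = 2 * (k * N).
  rewrite mulnA [_ * N]mulnC big_distrl -big_split; apply: eq_bigr => i _ /=.
  by rewrite -mulnDr subnK //; have := ltn_ord i; lia.
have ME := min_sum_noninc _ _ n_noninc.
(* Whether v and w are antipodal decides where the missing k is saved. *)
have [/forallP dE|] := boolP [forall i, d i == n i].
  have i0 : 'I_k := Ordinal k_gt0.
  have di0 : 0 < d i0 by rewrite (eqP (dE i0)) ltnW.
  (* All 2k edges at v are candidates, so the edge to u' has color 1 again. *)
  have [u' [l [vu' dl dlE cu']]] :=
    torus_exchange _ _ _ _ _ _ _ _ n_ge2 cint vu di0.
  have u'v : adj u' v by rewrite adj_sym.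
  have gap := torus_color_gap _ _ _ _ _ _ _ _ n_ge2 cint u'v wz.
  rewrite [[set u'] :|: _]setUC in gap.
  have DE := sum_decrement _ _ _ _ dl dlE; have M := min_sum_step _ _ _ _ dl dlE.
  have act : \sum_(j < k) (0 < d j) = k.
    rewrite -[RHS]card_ord -sum1_card; apply: eq_bigr => j _.
    by rewrite (eqP (dE j)) ltnW.
  have anti : \sum_(j < k) (d j == n j) = k.
    by rewrite -[RHS]card_ord -sum1_card; apply: eq_bigr => j _; rewrite dE.
  have DN : D = N by apply: eq_bigr => j _; apply/eqP.
  have MN : min_sum d = min_sum n.
    by apply: eq_bigr => i _; apply: eq_bigr => j _; rewrite !(eqP (dE _)).
  rewrite -/d act MN in M; rewrite -/d act anti c1 in cu'.
  rewrite -/d -/D DN in DE; rewrite -/N in ME; rewrite DE mulnS in NE.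
  move: gap; rewrite ct; lia.
rewrite negb_forall => /existsP[i di].
have gap := torus_color_gap _ _ _ _ _ _ _ _ n_ge2 cint vu wz.
have M := min_sum_mono _ _ _ dn; have S : \sum_(i < k) (n i - d i) + D = N.
  by rewrite -big_split; apply: eq_bigr => j _ /=; rewrite subnK.
have S0 : 0 < \sum_(i < k) (n i - d i).
  by rewrite (bigD1 i) //= addn_gt0 subn_gt0 ltn_neqAle di dn.
rewrite c1 ct -/d -/D in gap; rewrite -/N -{}S mulnDr in NE ME.
have := leq_mul (leqnn k) S0; rewrite muln1.
lia.
Qed.
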